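(* Let $q$ be a prime power, let $C\subseteq\mathbb{F}_q^n$ be an $\mathbb{F}_q$-linear code of length $n$, let $X_1,\dots,X_\ell$ be mutually disjoint subsets of $[n]$ with $X_1\sqcup\cdots\sqcup X_\ell=[n]$, and let $\chi$ be a non-trivial character of $\mathbb{F}_q$. Then $$\mathbf{scwe}_{C^{\perp},X_1,\dots,X_\ell}\big(\{\{x_{X_i,a}\}_{a\in\mathbb{F}_q}\}_{1\le i\le\ell}\big)=\frac{1}{|C|}\,\mathbf{scwe}_{C,X_1,\dots,X_\ell}\left(\left\{\left\{\sum_{b\in\mathbb{F}_q}\chi(ab)\,x_{X_i,b}\right\}_{a\in\mathbb{F}_q}\right\}_{1\le i\le\ell}\right),$$ i.e. the right-hand side is obtained from $\mathbf{scwe}_{C,X_1,\dots,X_\ell}$ by substituting $\sum_{b\in\mathbb{F}_q}\chi(ab)x_{X_i,b}$ for each variable $x_{X_i,a}$.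
   Context: $[n]=\{1,\dots,n\}$. An $\mathbb{F}_q$-linear code of length $n$ is a vector subspace of $\mathbb{F}_q^n$. The inner product is $\mathbf{u}\cdot\mathbf{v}=u_1v_1+\cdots+u_nv_n$ and $C^\perp=\{\mathbf{v}\in\mathbb{F}_q^n\mid \mathbf{u}\cdot\mathbf{v}=0\text{ for all }\mathbf{u}\in C\}$. A character of $\mathbb{F}_q$ is a homomorphism from the additive group $\mathbb{F}_q$ to the multiplicative group $\mathbb{C}^\times$. For $X\subseteq[n]$, $a\in\mathbb{F}_q$, $\mathbf{u}\in\mathbb{F}_q^n$, put $n_{a,X}(\mathbf{u})=\#\{i\in X\mid u_i=a\}$. The split complete weight enumerator of $C$ attached to a partition $[n]=X_1\sqcup\cdots\sqcup X_\ell$ is the polynomial (complex coefficients, commuting variables $x_{X_i,a}$ for $1\le i\le\ell$, $a\in\mathbb{F}_q$) $$\mathbf{scwe}_{C,X_1,\dots,X_\ell}\big(\{\{x_{X_i,a}\}_{a}\}_{i}\big)=\sum_{\mathbf{u}\in C}\prod_{i=1}^{\ell}\prod_{a\in\mathbb{F}_q}x_{X_i,a}^{\,n_{a,X_i}(\mathbf{u})}.$$ *)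

(* Defs.v *)
From HB Require Import structures.
From mathcomp Require Import all_boot all_order all_algebra all_field.
From mathcomp Require Import reals complex.
From mathcomp Require Import mpoly.

Set Implicit Arguments.
Unset Strict Implicit.
Unset Printing Implicit Defensive.

Import GRing.Theory.

Local Open Scope ring_scope.

Definition dot (F : finFieldType) (n : nat) (u v : 'rV[F]_n) : F^o :=
  \sum_(i < n) u 0 i * v 0 i.

Lemma dot_is_linear (F : finFieldType) (n : nat) (u : 'rV[F]_n) :
  linear (dot u).
Proof.
move=> k v w; rewrite /dot scaler_sumr -big_split /=.
by apply: eq_bigr => i _; rewrite !mxE mulrDr mulrCA.
Qed.

HB.instance Definition _ (F : finFieldType) (n : nat) (u : 'rV[F]_n) :=
  GRing.isLinear.Build F 'rV[F]_n F^o _ (dot u) (dot_is_linear u).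

(* The intersection of the hyperplanes u^\perp for u in C, so that the dual
   is again a subspace by construction; see dual_codeP. *)
Definition dual_code (F : finFieldType) (n : nat) (C : {vspace 'rV[F]_n}) :
    {vspace 'rV[F]_n} :=
  (\bigcap_(u in C) lker (linfun (dot u)))%VS.

Lemma dual_codeP (F : finFieldType) (n : nat) (C : {vspace 'rV[F]_n})
    (v : 'rV[F]_n) :
  reflect (forall u, u \in C -> dot u v = 0) (v \in dual_code C).
Proof.
rewrite memvE; apply: (iffP subv_bigcapP) => vC u uC.
  by have := vC u uC; rewrite -memvE memv_ker lfunE => /eqP.
by rewrite -memvE memv_ker lfunE /= vC.
Qed.

Definition is_character (R : realType) (F : finFieldType)
    (chi : F -> R[i]) : Prop :=
  (forall a, chi a != 0) /\ {morph chi : a b / a + b >-> a * b}.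

Definition nontrivial_character (R : realType) (F : finFieldType)
    (chi : F -> R[i]) : Prop :=
  is_character chi /\ exists a, chi a != 1.

Definition ncoord (F : finFieldType) (n : nat) (a : F) (X : {set 'I_n})
    (u : 'rV[F]_n) : nat :=
  #|[set i in X | u 0 i == a]|.

(* Complex polynomials in the variables x_(i, a), (i, a) in 'I_l * F: the
   index set is numbered by enum_rank, as mpoly variables are ordinals. *)
Definition xvar (R : realType) (F : finFieldType) (l : nat)
    (i : 'I_l) (a : F) : {mpoly R[i][#|{: 'I_l * F}|]} :=
  'X_(enum_rank (i, a)).

Definition scwe (R : realType) (F : finFieldType) (n l : nat)
    (C : {vspace 'rV[F]_n}) (X : 'I_l -> {set 'I_n}) :
    {mpoly R[i][#|{: 'I_l * F}|]} :=
  \sum_(u in C) \prod_(i < l) \prod_(a : F) xvar R i a ^+ ncoord a (X i) u.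

(* Simultaneous substitution of f i a for every variable x_(i, a). *)
Definition subst_vars (R : realType) (F : finFieldType) (l : nat)
    (p : {mpoly R[i][#|{: 'I_l * F}|]})
    (f : 'I_l -> F -> {mpoly R[i][#|{: 'I_l * F}|]}) :
    {mpoly R[i][#|{: 'I_l * F}|]} :=
  comp_mpoly [tuple f (enum_val k).1 (enum_val k).2 | k < #|{: 'I_l * F}|] p.

Lemma subst_vars_xvar (R : realType) (F : finFieldType) (l : nat)
    (f : 'I_l -> F -> {mpoly R[i][#|{: 'I_l * F}|]}) (i : 'I_l) (a : F) :
  subst_vars (xvar R i a) f = f i a.
Proof. by rewrite /subst_vars /xvar comp_mpolyXU -tnth_nth tnth_mktuple enum_rankK. Qed.

(* Main.v *)
(* A coordinate j in the block X_i contributes the variable x_(X_i, u_j), so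
   scwe is a sum over u of products over coordinates. Expanding the product of
   the transformed variables turns the right-hand side into
     \sum_v (\sum_(u in C) chi (u . v)) \prod_j x_(X_i, v_j),
   and the inner character sum is |C| if v is in the dual and 0 otherwise. *)
Require Import Defs.
From mathcomp Require Import all_boot all_order all_algebra all_field.
From mathcomp Require Import reals complex.
From mathcomp Require Import mpoly.

Import GRing.Theory.

Local Open Scope ring_scope.

Lemma dotC {F : finFieldType} {n : nat} (u v : 'rV[F]_n) : dot u v = dot v u.
Proof. by apply: eq_bigr => i _; rewrite mulrC. Qed.

Section Characters.

Context {R : realType} {F : finFieldType} {chi : F -> R[i]}.

Lemma character0 : is_character chi -> chi 0 = 1.
Proof.
move=> [chi_neq0 chiD]; apply: (mulfI (chi_neq0 0)).
by rewrite -chiD addr0 mulr1.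
Qed.

Lemma character_sum {I : Type} (r : seq I) (f : I -> F) :
  is_character chi -> chi (\sum_(i <- r) f i) = \prod_(i <- r) chi (f i).
Proof.
by move=> chiP; apply: big_morph; [exact: chiP.2 | exact: character0].
Qed.

Lemma sum_character_dot {n : nat} (C : {vspace 'rV[F]_n}) (v : 'rV[F]_n) :
  nontrivial_character chi ->
  \sum_(u in C) chi (dot u v) = if v \in dual_code C then #|C|%:R else 0.
Proof.
move=> [chiP [a chi_a]]; case: ifPn => [/dual_codeP vC | vNC].
  rewrite -sumr_const; apply: eq_bigr => u uC.
  by rewrite vC // character0.
have [w wC dwv] : exists2 w, w \in C & dot w v != 0.
  apply/exists_inP; apply: contraNT vNC; rewrite negb_exists_in.
  by move=> /forall_inP h; apply/dual_codeP => u /h; rewrite negbK => /eqP.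
(* As [dot w v] is invertible, [w] can be rescaled within [C] so that its product with [v] is the
   [a] at which [chi] differs from 1. *)
pose w' := (a / dot w v) *: w.
have w'C : w' \in C by rewrite memvZ.
have dw'v : dot w' v = a.
  (* Linearity is registered in the second argument of [dot], hence the swaps. *)
  by rewrite dotC linearZ /= (dotC v) [LHS]divfK.
(* The sum is invariant under translation by w', which multiplies it by chi a. *)
set S := \sum_(u in C) _.
have SE : S = chi a * S.
  rewrite {1}/S (reindex_inj (addrI w')) mulr_sumr /=.
  apply: eq_big => u; first by rewrite rpredDl.
  by move=> _; rewrite -chiP.2 dotC linearD /= !(dotC v) dw'v.
apply/eqP; have /eqP : (1 - chi a) * S = 0 by rewrite mulrBl mul1r -SE subrr.
by rewrite mulf_eq0 subr_eq0 eq_sym (negPf chi_a).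
Qed.

End Characters.

(** Sort the coordinates by block [i], then by value [a]: each class has [ncoord a (X i) u] members,
    all with the same factor [f i a]. *)
Lemma prod_ncoord {A : comNzRingType} {F : finFieldType} {n l : nat}
    (X : 'I_l -> {set 'I_n}) (blk : 'I_n -> 'I_l) (f : 'I_l -> F -> A)
    (u : 'rV[F]_n) :
  (forall i j, (j \in X i) = (blk j == i)) ->
  \prod_(i < l) \prod_(a : F) f i a ^+ ncoord a (X i) u =
  \prod_(j < n) f (blk j) (u 0 j).
Proof.
move=> XE; rewrite (partition_big blk xpredT) //=; apply: eq_bigr => i _.
rewrite (partition_big (fun j => u 0 j) xpredT) //=; apply: eq_bigr => a _.
rewrite /ncoord -prodr_const; apply: eq_big => j; first by rewrite inE XE.
by rewrite inE XE => /andP[/eqP-> /eqP->].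
Qed.

(** Covering gives each coordinate a block label, and disjointness makes it the only one. Empty
    blocks are allowed. *)
Lemma disjoint_cover_block {n l : nat} (X : 'I_l -> {set 'I_n}) :
  (forall i j : 'I_l, i != j -> [disjoint X i & X j]) ->
  \bigcup_(i < l) X i = [set: 'I_n] ->
  exists blk : 'I_n -> 'I_l, forall i j, (j \in X i) = (blk j == i).
Proof.
move=> Xdisj Xcov.
have /fin_all_exists [blk blkP] : forall j, exists i, j \in X i.
  move=> j; have : j \in \bigcup_(i < l) X i by rewrite Xcov inE.
  by case/bigcupP => i _; exists i.
exists blk => i j; have [<-|neq] := eqVneq; first exact: blkP.
exact: disjointFr (Xdisj _ _ neq) (blkP j).
Qed.

(** Distributivity: choosing one term in each factor amounts to choosing a row vector [v]. *)
Lemma prod_sum_row {A : comNzRingType} {F : finFieldType} {n : nat}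
    (f : 'I_n -> F -> A) :
  \prod_(j < n) \sum_(b : F) f j b = \sum_(v : 'rV[F]_n) \prod_(j < n) f j (v 0 j).
Proof.
rewrite bigA_distr_bigA /= (reindex (fun v : 'rV[F]_n => [ffun j => v 0 j])).
  by apply: eq_bigr => v _; apply: eq_bigr => j _; rewrite ffunE.
exists (fun g : {ffun 'I_n -> F} => \row_j g j) => g _.
  by apply/rowP => j; rewrite mxE ffunE.
by apply/ffunP => j; rewrite ffunE mxE.
Qed.

Lemma subst_vars_scwe {R : realType} {F : finFieldType} {n l : nat}
    (C : {vspace 'rV[F]_n}) (X : 'I_l -> {set 'I_n})
    (f : 'I_l -> F -> {mpoly R[i][#|{: 'I_l * F}|]}) :
  subst_vars (scwe R C X) f =
  \sum_(u in C) \prod_(i < l) \prod_(a : F) f i a ^+ ncoord a (X i) u.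
Proof.
rewrite /subst_vars /scwe rmorph_sum; apply: eq_bigr => u _.
rewrite rmorph_prod; apply: eq_bigr => i _.
rewrite rmorph_prod; apply: eq_bigr => a _.
by rewrite rmorphXn; congr (_ ^+ _); exact: subst_vars_xvar.
Qed.

Theorem theorem2p2 (R : realType) (F : finFieldType) (n l : nat)
    (C : {vspace 'rV[F]_n}) (X : 'I_l -> {set 'I_n})
    (X_disjoint : forall i j : 'I_l, i != j -> [disjoint X i & X j])
    (X_cover : \bigcup_(i < l) X i = [set: 'I_n])
    (chi : F -> R[i]) (chi_nontrivial : nontrivial_character chi) :
  scwe R (dual_code C) X =
  (#|C|%:R : R[i])^-1 *:
    subst_vars (scwe R C X)
      (fun (i : 'I_l) (a : F) => \sum_(b : F) chi (a * b) *: xvar R i b).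
Proof.
have [blk XE] := disjoint_cover_block X X_disjoint X_cover.
have C_neq0 : #|C|%:R != 0 :> R[i].
  by rewrite Num.Theory.pnatr_eq0 -lt0n; apply/card_gt0P; exists 0; exact: mem0v.
rewrite subst_vars_scwe.
under eq_bigr => u _.
  rewrite (prod_ncoord X blk) // prod_sum_row.
  under eq_bigr => v _ do
    (* The scalars gather into a single value of [chi], whose argument unfolds to [dot u v]. *)
    rewrite scaler_prod -(character_sum _ _ chi_nontrivial.1).
  over.
(* With the sum over the dual extended by zero to all [v], the two sides can be compared term by
   term. *)
rewrite exchange_big /= scaler_sumr /scwe [LHS]big_mkcond /=.
apply: eq_bigr => v _; rewrite -scaler_suml.
rewrite (sum_character_dot _ _ chi_nontrivial).
case: ifP => _; last by rewrite scale0r scaler0.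
by rewrite scalerA mulVf // scale1r (prod_ncoord X blk).
Qed.
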